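(* Let $X,Y$ be compact metric spaces, $S$ a real Banach space, $\mathcal{F}\subset S^*$ a linear subspace separating the points of $S$, $\mu=(\frac{d\mu}{d|\mu|},|\mu|)\in\mathcal{M}(X,S)$ and $\nu\in\mathcal{M}(Y,S)$. Assume: (i) for any measurable $A\subset X$ there exist a measurable $B\subset A$ and $\alpha\in(0,1)$ such that $\mu(B)=\alpha\mu(A)$, and for any measurable $A\subset Y$ there exist a measurable $B\subset A$ and $\alpha\in(0,1)$ such that $\nu(B)=\alpha\nu(A)$; (ii) there exists $f\in C(X,\mathcal{F})$ with $\langle f(x),\frac{d\mu}{d|\mu|}(x)\rangle=1$ for all $x\in X$; (iii) $Y$ is complete. Then $\mu$ sequentially dominates $\nu$ if and only if $\mathcal{T}(\mu,\nu)\neq\emptyset$, i.e. iff there exists a measurable map $T:X\to Y$ with $T_\#\mu=\nu$.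
   Context: Metric spaces carry their Borel $\sigma$-algebras. $\mathcal{M}_+(\Omega)$ is the set of finite non-negative (Borel) measures on $\Omega$. $\mathcal{M}(\Omega,S)$ is the set of $S$-valued measures $\mu$ of the form $\mu(A)=\int_A\eta\,d|\mu|$ (Bochner integral) for some $|\mu|\in\mathcal{M}_+(\Omega)$ and some Bochner integrable $\eta:\Omega\to S$; one writes $\mu=(\eta,|\mu|)$ and $\eta=\frac{d\mu}{d|\mu|}$ (such a representation is fixed). $C(X,\mathcal{F})$ is the space of continuous functions into $\mathcal{F}$ with the norm of $S^*$. $T_\#\mu=\nu$ means $\mu(T^{-1}(B))=\nu(B)$ for all measurable $B\subset Y$; $\mathcal{T}(\mu,\nu)$ is the set of measurable $T:X\to Y$ with this property. Partitions are finite and into measurable sets (parts may be empty). A partition $\{C_1,\dots,C_m\}$ is a refinement of a partition $\{D_1,\dots,D_n\}$ if every $C_i$ is contained in some $D_j$. $\mu\in\mathcal{M}(X,S)$ sequentially dominates $\nu\in\mathcal{M}(Y,S)$ if for any sequence $\{\mathcal{B}^n=\{B_1^n,\dots,B_{M_n}^n\}\}_{n=1}^\infty$ of partitions of $Y$ such that $\mathcal{B}^{n+1}$ is a refinement of $\mathcal{B}^n$ for all $n$, there exists a sequence $\{\mathcal{A}^n=\{A_1^n,\dots,A_{M_n}^n\}\}_{n=1}^\infty$ of partitions of $X$ such that: $\mathcal{A}^{n+1}$ is a refinement of $\mathcal{A}^n$ for all $n$; $\mu(A_i^n)=\nu(B_i^n)$ for any $n$ and $i=1,\dots,M_n$; and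 $B_i^{n+1}\subset B_j^n\Leftrightarrow A_i^{n+1}\subset A_j^n$ for any $n$, $j=1,\dots,M_n$, $i=1,\dots,M_{n+1}$.
   Formalization: X and Y are taken nonempty, and it is additionally assumed that if μ=0 and X is finite then Y has at most as many points as X; otherwise the claim fails, e.g. X one point, Y two points, μ=ν=0. *)

(* Defs.v *)
From HB Require Import structures.
From mathcomp Require Import all_boot all_order all_algebra.
From mathcomp Require Import all_classical all_reals all_analysis.

Set Implicit Arguments.
Unset Strict Implicit.
Unset Printing Implicit Defensive.

Import Order.TTheory GRing.Theory Num.Theory.
Import numFieldNormedType.Exports.

Local Open Scope classical_set_scope.
Local Open Scope ring_scope.

(* Measurable types are pointed in MathComp-Analysis, so metric spaces that
   carry a Borel sigma-algebra are nonempty. *)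
#[short(type="pmetricType")]
HB.structure Definition PMetric (K : numDomainType) :=
  {T of Metric K T & Pointed T}.

Notation borel T := (g_sigma_algebraType (@open T)).

Definition complete_space (T : puniformType) : Prop :=
  forall F : set_system T, ProperFilter F -> cauchy F -> cvg F.

Section bochner.
Context {R : realType} {S : completeNormedModType R}.
Context {d : measure_display} {T : measurableType d}.
Implicit Types (m : {finite_measure set T -> \bar R}) (eta : T -> S).

Definition simple_fun (s : T -> S) : Prop :=
  finite_set (range s) /\ forall v, measurable (s @^-1` [set v]).

Definition simple_integral m (A : set T) (s : T -> S) : S :=
  \sum_(v \in range s) fine (m (A `&` s @^-1` [set v])) *: v.

(* The integrands below are a.e. limits of measurable functions, hence agree
   with a measurable function off a null set; on such nonnegative functions the
   integral of the library (a supremum over simple minorants) is the usual one. *)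
Definition bochner_approx m eta (s : nat -> T -> S) : Prop :=
  [/\ forall n, simple_fun (s n),
      {ae m, forall x, s n x @[n --> \oo] --> eta x} &
      (\int[m]_x `|s n x - eta x|%:E)%E @[n --> \oo] --> 0%E].

Definition bochner_integrable m eta : Prop := exists s, bochner_approx m eta s.

(* For a Bochner integrable eta the limit exists and does not depend on the
   approximating sequence. *)
Definition bochner_integral m (A : set T) eta : S :=
  get [set v | exists2 s, bochner_approx m eta s &
                 simple_integral m A (s n) @[n --> \oo] --> v].

End bochner.

(* An element (eta, |mu|) of M(Omega, S), with its fixed representation; |mu| is
   any finite measure, not necessarily the total variation of mu. *)
Record vmeasure {R : realType} {d : measure_display} (T : measurableType d)
    (S : completeNormedModType R) := VMeasure {
  vbase : {finite_measure set T -> \bar R} ;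
  vdensity : T -> S ;
  vdensity_integrable : bochner_integrable vbase vdensity }.

Definition vmeasure_fun {R : realType} {d : measure_display}
    {T : measurableType d} {S : completeNormedModType R} (mu : vmeasure T S)
    (A : set T) : S :=
  bochner_integral (vbase mu) A (vdensity mu).

Coercion vmeasure_fun : vmeasure >-> Funclass.

Section dual.
Context {R : realType} {S : normedModType R}.

Definition in_dual (phi : S -> R^o) : Prop := linear phi /\ continuous phi.

Definition dual_norm (phi : S -> R^o) : R :=
  sup [set `|phi s| | s in [set s : S | `|s| <= 1]].

Definition dual_subspace (F : set (S -> R^o)) : Prop :=
  [/\ forall phi, F phi -> in_dual phi,
      F (fun=> 0) &
      forall (a : R) phi psi, F phi -> F psi -> F (fun s => a *: phi s + psi s)].

Definition separates_points (F : set (S -> R^o)) : Prop :=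
  forall s t : S, s <> t -> exists2 phi, F phi & phi s <> phi t.

(* C(X, F) *)
Definition dual_continuous {X : topologicalType} (F : set (S -> R^o))
    (f : X -> S -> R^o) : Prop :=
  (forall x, F (f x)) /\
  (forall x (e : R), 0 < e ->
     \forall y \near x, dual_norm (fun s => f y s - f x s) < e).

End dual.

Section partitions.
Context {d : measure_display} {T : measurableType d}.

(* Finite measurable partitions are indexed families; parts may be empty. *)
Definition mpartition n (A : 'I_n -> set T) : Prop :=
  [/\ forall i, measurable (A i), trivIset setT A & \bigcup_i A i = setT].

Definition refinement m n (C : 'I_m -> set T) (D : 'I_n -> set T) : Prop :=
  forall i, exists j, C i `<=` D j.

End partitions.

Section vector_measures.
Context {R : realType} {S : completeNormedModType R}.

Definition has_fractions {d : measure_display} {T : measurableType d}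
    (mu : vmeasure T S) : Prop :=
  forall A, measurable A -> exists B (alpha : R),
    [/\ measurable B, B `<=` A, 0 < alpha < 1 & mu B = alpha *: mu A].

Context {d1 d2 : measure_display} {X : measurableType d1} {Y : measurableType d2}.

Definition transport_maps (mu : vmeasure X S) (nu : vmeasure Y S) :
    set (X -> Y) :=
  [set f | measurable_fun setT f /\
           forall B, measurable B -> mu (f @^-1` B) = nu B].

Definition seq_dominates (mu : vmeasure X S) (nu : vmeasure Y S) : Prop :=
  forall (M : nat -> nat) (B : forall n, 'I_(M n) -> set Y),
    (forall n, mpartition (B n)) ->
    (forall n, refinement (B n.+1) (B n)) ->
    exists A : forall n, 'I_(M n) -> set X,
      [/\ forall n, mpartition (A n),
          forall n, refinement (A n.+1) (A n),
          forall n i, mu (A n i) = nu (B n i) &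
          forall n (j : 'I_(M n)) (i : 'I_(M n.+1)),
            B n.+1 i `<=` B n j <-> A n.+1 i `<=` A n j].

End vector_measures.

(* Main.v *)
Require Import Defs.
From HB Require Import structures.
From mathcomp Require Import all_boot all_order all_algebra.
From mathcomp Require Import all_classical all_reals all_analysis.
From mathcomp Require Import measurable_realfun ring.

Set Implicit Arguments.
Unset Strict Implicit.
Unset Printing Implicit Defensive.

Import Order.TTheory GRing.Theory Num.Theory.
Import numFieldNormedType.Exports.

Local Open Scope classical_set_scope.
Local Open Scope ring_scope.

(* From domination to a map: by compactness [Y] has a refining sequence of
   partitions with diameters tending to [0].  A point [x] of [X] selects a
   decreasing sequence of parts of the matching partitions of [X], hence of parts
   of [Y], and [T x] is a point of the closures of all of the latter.  For a
   closed [C], [T @^-1` C] is the decreasing intersection of the unions of the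
   parts of [X] whose counterpart in [Y] has a closure meeting [C], and [C] is the
   intersection of the corresponding unions in [Y]; continuity from above gives
   [mu (T @^-1` C) = nu C], which extends to Borel sets by a Dynkin argument.
   From a map to domination: preimages of partitions work except that a nonempty
   part may have an empty preimage.  The fractions property and [f] force points
   of [X] to be null, so [T] can be changed on a countable set in order to hit
   every nonempty part. *)

(** * Integrals of simple functions *)

Section simple_functions.
Context {R : realType} {d : measure_display} {T : measurableType d}.
Variable m : {finite_measure set T -> \bar R}.

Lemma finite_fibers_preimage_measurable (U : choiceType) (u : T -> U) :
  finite_set (range u) -> (forall w, measurable (u @^-1` [set w])) ->
  forall P : set U, measurable (u @^-1` P).
Proof.
move=> fu mu P.
rewrite (_ : _ @^-1` _ = \bigcup_(w in range u `&` P) (u @^-1` [set w])).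
  by apply: fin_bigcup_measurable => //; exact: finite_setIl.
apply/seteqP; split=> [x Px|x [w [_ Pw]] /= ->//].
by exists (u x) => //; split => //; exists x.
Qed.

Lemma fine_measure_fibers (U : choiceType) (u : T -> U) (A : set T) :
  finite_set (range u) -> (forall w, measurable (u @^-1` [set w])) ->
  measurable A ->
  fine (m A) = \sum_(w \in range u) fine (m (A `&` u @^-1` [set w])).
Proof.
move=> fu mu mA; apply: EFin_inj.
rewrite fineK ?fin_num_measure// fsbig_finite//= -sumEFin -fsbig_finite//=.
rewrite {1}(_ : A = \big[setU/set0]_(w \in range u) (A `&` u @^-1` [set w])).
  rewrite measure_fsbig//; last 2 first.
  - by move=> w _; exact: measurableI.
  - by move=> v w _ _ [x [[_ /= <-] [_ /= <-]]].
  apply: eq_fsbigr => w _; rewrite fineK// fin_num_measure//; exact: measurableI.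
rewrite fsbig_setU//; apply/seteqP; split=> [x Ax|x [w _ []]//].
by exists (u x) => //; exists x.
Qed.

Context {S : completeNormedModType R}.

(** Each fiber of [g \o u] is split along [u]; after exchanging the sums only [v = g w] survives.
    This lets several simple functions be integrated over one family of fibers. *)
Lemma simple_integral_comp (U : choiceType) (u : T -> U) (g : U -> S)
    (A : set T) :
  finite_set (range u) -> (forall w, measurable (u @^-1` [set w])) ->
  measurable A ->
  simple_integral m A (g \o u) =
  \sum_(w \in range u) fine (m (A `&` u @^-1` [set w])) *: g w.
Proof.
move=> fu mu mA.
have fgu : finite_set (range (g \o u)).
  by rewrite -(image_comp u g); exact: finite_image.
have mP P := finite_fibers_preimage_measurable fu mu P.
rewrite /simple_integral.
transitivity (\sum_(v \in range (g \o u)) \sum_(w \in range u)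
    fine (m (A `&` (g \o u) @^-1` [set v] `&` u @^-1` [set w])) *: v).
  apply: eq_fsbigr => v _; rewrite (fine_measure_fibers fu mu); last first.
    by apply: measurableI => //; exact: (mP (g @^-1` [set v])).
  by rewrite !fsbig_finite//= scaler_suml.
rewrite exchange_fsbig//; apply: eq_fsbigr => w /set_mem[x _ uxw].
rewrite -(@fsbig_widen _ _ _ _ [set g w]).
- rewrite fsbig_set1 -setIA; congr (fine (m (_ `&` _)) *: _).
  by apply/seteqP; split=> [y []//|y /= <-].
- by move=> v ->; exists x => //=; rewrite uxw.
- move=> v [_ /= vgw]; rewrite (_ : _ `&` _ = set0) ?measure0 ?scale0r//.
  by rewrite -subset0 => y [[_ /= guy] uyw]; apply: vgw; rewrite -uyw guy.
Qed.

Lemma simple_comp_measurable (U : choiceType) (u : T -> U) (h : U -> R) :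
  finite_set (range u) -> (forall w, measurable (u @^-1` [set w])) ->
  measurable_fun setT (h \o u).
Proof.
move=> fu mu _ B _; rewrite setTI.
exact: (finite_fibers_preimage_measurable fu mu (h @^-1` B)).
Qed.

(** Triangle inequality with [A] enlarged to the whole space: the bound is independent of [A], which
    later makes approximations uniform in [A]. *)
Lemma norm_simple_integral_comp (U : choiceType) (u : T -> U) (g : U -> S)
    (A : set T) :
  finite_set (range u) -> (forall w, measurable (u @^-1` [set w])) ->
  measurable A ->
  (`|simple_integral m A (g \o u)|%:E <= \int[m]_x `|g (u x)|%:E)%E.
Proof.
move=> fu mu mA; rewrite simple_integral_comp// fsbig_finite//=.
have -> : (\int[m]_x `|g (u x)|%:E =
  \sum_(w \in range u) (`|g w|%:E * m (u @^-1` [set w])))%E.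
  transitivity (\int[m]_x (\sum_(w \in range u)
      (`|g w| * \1_(u @^-1` [set w]) x)%:E)%E)%E.
    apply: eq_integral => x _.
    rewrite -(@fsbig_widen _ _ _ _ [set u x]).
    - by rewrite fsbig_set1 indicE mem_set//= mulr1.
    - by move=> v /= ->; exists x.
    - move=> v [_ /= vux]; rewrite indicE memNset/= ?mulr0//.
      by move=> /esym.
  rewrite ge0_integral_fsum//.
  - apply: eq_fsbigr => w _.
    under eq_integral do rewrite EFinM.
    by rewrite ge0_integralZl_EFin ?integral_indic ?setIT//;
      apply/measurable_EFinP; exact: measurable_indic.
  - move=> w; apply/measurable_EFinP.
    by apply: measurable_funM => //; exact: measurable_indic.
rewrite fsbig_finite//=.
have := ler_norm_sum (finmap.enum_fset (fset_set (range u)))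
  (fun w => fine (m (A `&` u @^-1` [set w])) *: g w) xpredT.
rewrite -lee_fin => /le_trans; apply.
rewrite -sumEFin; apply: lee_sum => w _.
have mAu : measurable (A `&` u @^-1` [set w]) by exact: measurableI.
rewrite normrZ ger0_norm ?fine_ge0// EFinM fineK ?fin_num_measure// muleC.
by rewrite lee_wpmul2l ?lee_fin// le_measure// inE.
Qed.

Lemma simple_fun_pair (s t : T -> S) : simple_fun s -> simple_fun t ->
  finite_set (range (fun x => (s x, t x))) /\
  forall w, measurable ((fun x => (s x, t x)) @^-1` [set w]).
Proof.
move=> [fs ms] [ft mt]; split.
  apply: (@sub_finite_set _ _ (range s `*` range t)); last exact: finite_setX.
  by move=> _ [x _ <-]; split; exists x.
move=> [v w]; rewrite (_ : _ @^-1` _ = s @^-1` [set v] `&` t @^-1` [set w]).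
  exact: measurableI.
by apply/seteqP; split=> [x /= [-> ->]//|x [/= -> ->]].
Qed.

(** With [u] the pair of [s] and [t], both integrals and that of the difference are sums over the
    same fibers. *)
Lemma simple_integral_dist (s t : T -> S) (A : set T) :
  simple_fun s -> simple_fun t -> measurable A ->
  (`|simple_integral m A s - simple_integral m A t|%:E <=
   \int[m]_x `|s x - t x|%:E)%E.
Proof.
move=> ss st mA; have [fu mu] := simple_fun_pair ss st.
have := norm_simple_integral_comp (fun w => w.1 - w.2) fu mu mA.
rewrite simple_integral_comp//.
have -> : simple_integral m A s = _ := simple_integral_comp fst fu mu mA.
have -> : simple_integral m A t = _ := simple_integral_comp snd fu mu mA.
apply: le_trans.
rewrite lee_fin !fsbig_finite//= -sumrB le_eqVlt; apply/orP; left.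
by apply/eqP; congr `|_|; apply: eq_bigr => w _; rewrite scalerBr.
Qed.

Lemma simple_dist_measurable (s t : T -> S) :
  simple_fun s -> simple_fun t -> measurable_fun setT (fun x => `|s x - t x|).
Proof.
move=> ss st; have [fu mu] := simple_fun_pair ss st.
exact: (simple_comp_measurable (fun w => `|w.1 - w.2|) fu mu).
Qed.

End simple_functions.

(** * Bochner integrals *)

Section bochner.
Context {R : realType} {d : measure_display} {T : measurableType d}.

(* No measurability is needed: the integral of a nonnegative function is a
   supremum over simple minorants. *)
Lemma ge0_subset_lower_integral (m : {measure set T -> \bar R}) (D : set T)
    (f : T -> \bar R) :
  (forall x, 0 <= f x)%E -> (\int[m]_(x in D) f x <= \int[m]_x f x)%E.
Proof.
move=> f0; rewrite integral_mkcond.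
have fD x : ((f \_ D) x <= f x)%E by rewrite /patch; case: ifP.
have fD0 x : (0 <= (f \_ D) x)%E by rewrite /patch; case: ifP.
rewrite !ge0_integralTE//.
apply: le_ereal_sup => _ [h /= hf <-]; exists h => // x.
exact: le_trans (fD x).
Qed.

Context {S : completeNormedModType R}.
Variable m : {finite_measure set T -> \bar R}.

(** The L1 triangle inequality through [eta]; allowing [s] and [t] to differ is what makes the
    integral independent of the sequence. *)
Lemma bochner_approx_dist (eta : T -> S) s t n k :
  bochner_approx m eta s -> bochner_approx m eta t ->
  (\int[m]_x `|s n x - t k x|%:E <=
   \int[m]_x `|s n x - eta x|%:E + \int[m]_x `|t k x - eta x|%:E)%E.
Proof.
move=> [ss [Ns [mNs Ns0 sNs]] _] [st [Nt [mNt Nt0 sNt]] _].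
pose N := Ns `|` Nt; have mN : measurable N by exact: measurableU.
have N0 : m N = 0%E by exact: null_set_setU.
have mC : measurable (~` N) by exact: measurableC.
have cs x : (~` N) x -> s n x @[n --> \oo] --> eta x.
  by move=> Nx; apply: contrapT => /sNs ?; apply: Nx; left.
have ct x : (~` N) x -> t n x @[n --> \oo] --> eta x.
  by move=> Nx; apply: contrapT => /sNt ?; apply: Nx; right.
(* [eta] itself need not be measurable, but off a null set [|u i - eta|] is
   a pointwise limit of the simple functions [|u i - u j|]. *)
have mu u i : (forall n, simple_fun (u n)) ->
    (forall x, (~` N) x -> u n x @[n --> \oo] --> eta x) ->
    measurable_fun (~` N) (fun x => `|u i x - eta x|%:E).
  move=> su cu; apply: (emeasurable_fun_cvg (fun j x => `|u i x - u j x|%:E)).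
    move=> j; apply/measurable_EFinP; apply: measurable_funTS.
    exact: simple_dist_measurable.
  move=> x Nx; apply: cvg_EFin; first exact: nearW.
  by apply: cvg_norm; apply: cvgB; [exact: cvg_cst|exact: cu].
have mst : measurable_fun setT (fun x => `|s n x - t k x|%:E).
  by apply/measurable_EFinP; exact: simple_dist_measurable.
rewrite (ge0_negligible_integral (D := setT) (N := N))// setTD.
apply: (@le_trans _ _
  (\int[m]_(x in ~` N) (`|s n x - eta x|%:E + `|t k x - eta x|%:E))%E).
  apply: ge0_le_integral => //.
  - exact: measurable_funTS.
  - by apply: emeasurable_funD; exact: mu.
  - move=> x _; rewrite -EFinD lee_fin (distrC (t k x)).
    exact: ler_distD.
rewrite ge0_integralD//; [|exact: mu|exact: mu].
by apply: leeD; exact: ge0_subset_lower_integral.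
Qed.

Lemma near_cvge0_lt (e : nat -> \bar R) (eps : R) : e @ \oo --> 0%E -> 0 < eps ->
  \forall n \near \oo, (e n < eps%:E)%E.
Proof.
move=> e0 eps0; have [efin ecvg] := (fine_cvgP _ _).1 e0.
near=> n; have nfin : e n \is a fin_num by near: n.
rewrite -(fineK nfin) lte_fin; near: n; exact: cvgr_lt ecvg eps eps0.
Unshelve. all: by end_near. Qed.

Lemma simple_integral_approx_dist (eta : T -> S) s t (eps : R) :
  bochner_approx m eta s -> bochner_approx m eta t -> 0 < eps ->
  exists N, forall n k A, measurable A -> (N <= n)%N -> (N <= k)%N ->
    `|simple_integral m A (s n) - simple_integral m A (t k)| < eps.
Proof.
move=> sa ta eps0; have [ss _ s0] := sa; have [st _ t0] := ta.
have eps2 : 0 < eps / 2 by exact: divr_gt0.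
have [Ns _ sNs] := near_cvge0_lt s0 eps2.
have [Nt _ tNt] := near_cvge0_lt t0 eps2.
exists (maxn Ns Nt) => n k A mA; rewrite !geq_max => /andP[nNs _] /andP[_ kNt].
rewrite -lte_fin (le_lt_trans (simple_integral_dist _ _ _ mA))//.
apply: le_lt_trans (bochner_approx_dist n k sa ta) _.
by rewrite (splitr eps) EFinD lteD//; [exact: sNs|exact: tNt].
Qed.

(** Completeness makes the integrals along [s] converge, so [get] selects from a nonempty set. The
    selected value comes from some sequence [t], whose integrals approach those along [s]. *)
Lemma bochner_integral_cvg (eta : T -> S) s (A : set T) :
  bochner_approx m eta s -> measurable A ->
  simple_integral m A (s n) @[n --> \oo] --> bochner_integral m A eta.
Proof.
move=> sa mA; rewrite /bochner_integral.
have : [set v : S | exists2 s, bochner_approx m eta s &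
    simple_integral m A (s n) @[n --> \oo] --> v] !=set0.
  suff : cvg (simple_integral m A (s n) @[n --> \oo]).
    by move=> /cvg_ex[v sv]; exists v; exists s.
  apply/cauchy_cvgP/cauchyP => eps eps0.
  have [N sN] := simple_integral_approx_dist sa sa eps0.
  exists (simple_integral m A (s N)); exists N => // n /= Nn.
  by rewrite -ball_normE; exact: sN.
move=> /getPex[t ta tv]; set v := get _ in tv *.
apply/cvgrPdist_lt => eps eps0.
have eps2 : 0 < eps / 2 by exact: divr_gt0.
have [N sN] := simple_integral_approx_dist ta sa eps2.
near=> n.
rewrite (splitr eps) (le_lt_trans (ler_distD (simple_integral m A (t n)) _ _))//.
rewrite ltrD//; first by near: n; apply: (cvgrPdist_lt _ _).1.
by apply: sN => //; near: n; exact: nbhs_infty_ge.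
Unshelve. all: by end_near. Qed.

Lemma bochner_integral_approx (eta : T -> S) (eps : R) :
  bochner_integrable m eta -> 0 < eps ->
  exists2 s : T -> S, simple_fun s & forall A, measurable A ->
    `|bochner_integral m A eta - simple_integral m A s| <= eps.
Proof.
move=> [s sa] eps0; have [ss _ _] := sa.
have [N sN] := simple_integral_approx_dist sa sa eps0.
exists (s N) => // A mA.
have c : `|simple_integral m A (s n) - simple_integral m A (s N)|
    @[n --> \oo] --> `|bochner_integral m A eta - simple_integral m A (s N)|.
  by apply: cvg_norm; apply: cvgB; [exact: bochner_integral_cvg|exact: cvg_cst].
apply: (closed_cvg (fun x : R => x <= eps)) c; first exact: closed_le.
by near=> n; apply/ltW/sN => //; near: n; exact: nbhs_infty_ge.
Unshelve. all: by end_near. Qed.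

End bochner.

(** * Vector measures *)

Section vmeasure_theory.
Context {R : realType} {d : measure_display} {T : measurableType d}.
Context {S : completeNormedModType R}.
Variable mu : vmeasure T S.
Local Notation m := (vbase mu).

Lemma vmeasure_approx (eps : R) : 0 < eps ->
  exists2 s : T -> S, simple_fun s & forall A, measurable A ->
    `|mu A - simple_integral m A s| <= eps.
Proof. exact: bochner_integral_approx (vdensity_integrable mu). Qed.

(** A simple function approximates [mu] uniformly over measurable sets, leaving a three-term
    estimate. Its integral involves only masses of intersections with fibers, hence the hypothesis
    on all [E]. *)
Lemma vmeasure_cvg (A : (set T)^nat) (B : set T) :
  (forall n, measurable (A n)) -> measurable B ->
  (forall E, measurable E -> m (A n `&` E) @[n --> \oo] --> m (B `&` E)) ->
  mu (A n) @[n --> \oo] --> mu B.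
Proof.
move=> mA mB AB; apply/cvgrPdist_le => eps eps0.
have eps3 : 0 < eps / 3 by exact: divr_gt0.
have [s [fs ms] sP] := vmeasure_approx eps3.
have c : simple_integral m (A n) s @[n --> \oo] --> simple_integral m B s.
  rewrite /simple_integral fsbig_finite//=; under eq_fun do rewrite fsbig_finite//=.
  apply: cvg_big => [|v _]; first exact: add_continuous.
  apply: cvgZr_tmp; apply: fine_cvg.
  rewrite fineK ?fin_num_measure//; last exact: measurableI.
  exact: AB.
near=> n.
rewrite (_ : mu B - mu (A n) = (mu B - simple_integral m B s) +
    (simple_integral m B s - simple_integral m (A n) s) +
    (simple_integral m (A n) s - mu (A n))); last first.
  by rewrite !addrA !subrK.
rewrite (_ : eps = eps / 3 + eps / 3 + eps / 3); last by field.
rewrite (le_trans (ler_normD _ _))// lerD//; last by rewrite distrC sP.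
rewrite (le_trans (ler_normD _ _))// lerD//; first exact: sP.
by near: n; exact: (cvgrPdist_le _ _).1.
Unshelve. all: by end_near. Qed.

Lemma vmeasure_eq (A B : set T) : measurable A -> measurable B ->
  (forall E, measurable E -> m (A `&` E) = m (B `&` E)) -> mu A = mu B.
Proof.
move=> mA mB AB.
have := @vmeasure_cvg (fun=> A) B (fun=> mA) mB.
have cA : mu A @[n --> \oo] --> mu A by exact: cvg_cst.
move=> /(_ _)/(cvg_unique _ cA); apply => //.
by move=> E mE; rewrite AB//; exact: cvg_cst.
Qed.

Lemma vmeasure_eq_off_null (A B N : set T) :
  measurable A -> measurable B -> measurable N -> m N = 0%E ->
  A `\` N = B `\` N -> mu A = mu B.
Proof.
move=> mA mB mN N0 AB; apply: vmeasure_eq => // E mE.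
have dN C : measurable C -> m C = m (C `\` N).
  move=> mC; rewrite (measureDI m mC mN).
  by rewrite (subset_measure0 _ _ (@subIsetr _ C N))// ?adde0//; exact: measurableI.
rewrite (dN (A `&` E)) ?(dN (B `&` E))//; try exact: measurableI.
by congr (m _); rewrite !setDE -!setIA (setIC E) !setIA -!setDE AB.
Qed.

Lemma simple_integralU (s : T -> S) (A B : set T) : simple_fun s ->
  measurable A -> measurable B -> A `&` B = set0 ->
  simple_integral m (A `|` B) s = simple_integral m A s + simple_integral m B s.
Proof.
move=> [fs ms] mA mB AB; rewrite /simple_integral !fsbig_finite//= -big_split/=.
apply: eq_bigr => v _; rewrite -scalerDl; congr (_ *: _).
have mAv : measurable (A `&` s @^-1` [set v]) by exact: measurableI.
have mBv : measurable (B `&` s @^-1` [set v]) by exact: measurableI.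
rewrite setIUl measureU//; last by rewrite setIACA AB set0I.
by rewrite fineD// fin_num_measure.
Qed.

Lemma vmeasureU (A B : set T) : measurable A -> measurable B ->
  A `&` B = set0 -> mu (A `|` B) = mu A + mu B.
Proof.
move=> mA mB AB; have [s sa] := vdensity_integrable mu; have [ss _ _] := sa.
have cU := bochner_integral_cvg sa (measurableU _ _ mA mB).
apply: (cvg_unique _ cU) => //=.
under eq_fun do rewrite simple_integralU//.
by apply: cvgD; exact: bochner_integral_cvg.
Qed.

Lemma vmeasure0 : mu set0 = 0.
Proof.
have := vmeasureU measurable0 measurable0 (setI0 _).
by rewrite setU0 -[LHS]addr0 => /addrI/esym.
Qed.

Lemma vmeasureC (A : set T) : measurable A -> mu (~` A) = mu setT - mu A.
Proof.
move=> mA; rewrite -(setUv A) vmeasureU ?setICr//; last exact: measurableC.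
by rewrite addrC addKr.
Qed.

Lemma vmeasure_bigsetU (I : choiceType) (r : seq I) (P : pred I) (F : I -> set T) :
  uniq r -> (forall i, measurable (F i)) -> trivIset setT F ->
  mu (\big[setU/set0]_(i <- r | P i) F i) = \sum_(i <- r | P i) mu (F i).
Proof.
move=> + mF tF; elim: r => [_|i r ih /= /andP[ir ur]].
  by rewrite !big_nil vmeasure0.
rewrite !big_cons -ih//; case: ifP => // Pi; rewrite vmeasureU//.
  by apply: bigsetU_measurable.
rewrite -subset0 => x [Fix]; rewrite -bigcup_seq_cond => -[j /= /andP[jr _] Fjx].
move: ir; rewrite (tF i j) ?jr//; by exists x.
Qed.

Lemma vmeasure_cvg_bigcup (F : (set T)^nat) : (forall n, measurable (F n)) ->
  nondecreasing_seq F -> mu (F n) @[n --> \oo] --> mu (\bigcup_n F n).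
Proof.
move=> mF ndF; apply: vmeasure_cvg => //; first exact: bigcupT_measurable.
move=> E mE; rewrite setI_bigcupl; apply: nondecreasing_cvg_mu.
- by move=> i; exact: measurableI.
- by apply: bigcupT_measurable => i; exact: measurableI.
- by move=> i j ij; apply/subsetPset; apply: setSI; apply/subsetPset; exact: ndF.
Qed.

Lemma vmeasure_cvg_bigcap (F : (set T)^nat) : (forall n, measurable (F n)) ->
  nonincreasing_seq F -> mu (F n) @[n --> \oo] --> mu (\bigcap_n F n).
Proof.
move=> mF niF; apply: vmeasure_cvg => //; first exact: bigcapT_measurable.
move=> E mE; have mFE i : measurable (F i `&` E) by exact: measurableI.
have -> : \bigcap_n F n `&` E = \bigcap_n (F n `&` E).
  apply/seteqP; split=> [x [Fx Ex] n _|x FEx]; first by split => //; exact: Fx.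
  by split => [n _|]; [exact: (FEx n I).1|exact: (FEx 0%N I).2].
apply: nonincreasing_cvg_mu => //.
- by rewrite ltey_eq fin_num_measure.
- exact: bigcapT_measurable.
- by move=> i j ij; apply/subsetPset; apply: setSI; apply/subsetPset; exact: niF.
Qed.

(** Integrals over the point only see [s n x]. Either the point is null and both sides vanish, or it
    lies outside the exceptional set [N] and [s n x] tends to the density. *)
Lemma vmeasure_set1 (x : T) : measurable [set x] ->
  mu [set x] = fine (m [set x]) *: vdensity mu x.
Proof.
move=> mx; have [s sa] := vdensity_integrable mu; have [ss [N [mN N0 sN]] _] := sa.
have cx := bochner_integral_cvg sa mx.
apply: (cvg_unique _ cx) => //=.
have -> : (fun n => simple_integral m [set x] (s n)) =
    (fun n => fine (m [set x]) *: s n x).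
  apply/funext => n; have [fs _] := ss n.
  rewrite /simple_integral -(@fsbig_widen _ _ _ _ [set s n x]).
  - rewrite fsbig_set1 (_ : _ `&` _ = [set x])//.
    by apply/seteqP; split=> [y []|y ->].
  - by move=> v /= ->; exists x.
  - move=> v [_ /= vs]; rewrite (_ : _ `&` _ = set0) ?measure0 ?scale0r//.
    by rewrite -subset0 => y [/= -> /esym].
have [x0|x0] := eqVneq (m [set x]) 0%E.
  by rewrite x0 scale0r; under eq_fun do rewrite scale0r; exact: cvg_cst.
apply: cvgZl_tmp; apply: contrapT => /sN Nx.
move: x0; rewrite -measure_le0 -N0 le_measure ?inE//.
by move=> y ->.
Qed.

End vmeasure_theory.

(** * Refining partitions *)

Section borel_transport.
Context {R : realType} {S : completeNormedModType R}.
Context {d : measure_display} {X : measurableType d} {Y : pmetricType R}.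
Variables (mu : vmeasure X S) (nu : vmeasure (borel Y) S).

Lemma open_measurable_borel (U : set Y) : open U -> measurable (U : set (borel Y)).
Proof. exact: sub_sigma_algebra. Qed.

Lemma closed_measurable_borel (C : set Y) :
  closed C -> measurable (C : set (borel Y)).
Proof.
move=> cC; rewrite -(setCK C); apply: measurableC.
by apply: open_measurable_borel; exact: closed_openC.
Qed.

Lemma transport_maps_closed (T : X -> borel Y) :
  (forall C : set Y, closed C -> measurable (T @^-1` C) /\ mu (T @^-1` C) = nu C) ->
  transport_maps mu nu T.
Proof.
move=> TC.
have mTO (O : set Y) : open O -> measurable (T @^-1` O).
  move=> oO; rewrite -(setCK O) preimage_setC; apply: measurableC.
  by have [] := TC _ (open_closedC oO).
have mT : measurable_fun setT T.
  apply: (@measurability _ _ _ (borel Y) setT T (@open Y)) => //.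
  by move=> _ [U oU <-]; rewrite setTI; exact: mTO.
have mTB (B : set (borel Y)) : measurable B -> measurable (T @^-1` B).
  by move=> mB; rewrite -[_ @^-1` _]setTI; exact: mT.
(* The whole space is closed, so total masses agree and equality passes to complements. *)
have TT : mu setT = nu setT by have [_] := TC setT closedT.
split => //; apply: (@dynkin_induction _ (borel Y) (@open Y)
  (fun B => mu (T @^-1` B) = nu B)) => //.
- exact: openI.
- move=> O oO; have cO : closed (~` O) by exact: open_closedC.
  have [mTC TCO] := TC _ cO; have mC := closed_measurable_borel cO.
  by rewrite -(setCK O) preimage_setC (vmeasureC mu mTC) (vmeasureC nu mC) TT TCO.
- move=> B mB TB.
  by rewrite preimage_setC (vmeasureC mu (mTB _ mB)) (vmeasureC nu mB) TT TB.
(* Disjoint unions: finite additivity on partial unions, then continuity from below on both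
   sides. *)
- move=> F mF tF TF.
  have ndU (Z : Type) (H : (set Z)^nat) :
      nondecreasing_seq (fun n => \big[setU/set0]_(i < n.+1) H i).
    by move=> i j ij; apply/subsetPset; exact: subset_bigsetU.
  have cY : nu (\big[setU/set0]_(i < n.+1) F i) @[n --> \oo] --> nu (\bigcup_k F k).
    rewrite -bigcup_bigsetU_bigcup; apply: vmeasure_cvg_bigcup => //.
    by move=> n; exact: bigsetU_measurable.
  have cX : mu (\big[setU/set0]_(i < n.+1) (T @^-1` F i)) @[n --> \oo] -->
      mu (T @^-1` (\bigcup_k F k)).
    rewrite preimage_bigcup -bigcup_bigsetU_bigcup.
    apply: vmeasure_cvg_bigcup => [n|]; last exact: (ndU X (fun i => T @^-1` F i)).
    by apply: bigsetU_measurable => i _; exact: mTB.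
  apply: (cvg_unique _ cX) => //=.
  rewrite (_ : (fun n => _) = (fun n => nu (\big[setU/set0]_(i < n.+1) F i)))//.
  have tFn n : trivIset setT (fun i : 'I_n.+1 => F i).
    by move=> i j _ _ Fij; apply: val_inj; exact: tF.
  apply/funext => n; rewrite !vmeasure_bigsetU ?index_enum_uniq//.
  + by apply: eq_bigr => i _; rewrite TF.
  + exact: tFn.
  + by move=> i; exact: mTB.
  + by move=> i j _ _ [x [Fi Fj]]; apply: (tFn n) => //; exists (T x).
Qed.

End borel_transport.

(** * Preimages of closed sets as limits of unions of parts *)

Section partition_limit.
Context {R : realType} {S : completeNormedModType R} {Y : pmetricType R}.
Variables (M : nat -> nat) (B : forall n, 'I_(M n) -> set Y).
Arguments B : clear implicits.

Hypothesis B_fine : forall e : R, 0 < e ->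
  exists n, forall i y z, B n i y -> B n i z -> ball y e z.

Definition meets (C : set Y) n : pred 'I_(M n) :=
  fun i => `[< closure (B n i) `&` C !=set0 >].
Arguments meets C n : clear implicits.

(** For the harder inclusion, take a level whose parts have points within [e / 3] of each other:
    [T z] is near a point of the part, which is near another one, which is near a point [q] of
    [C]. *)
Lemma preimage_closed_bigcap {Z : Type} (A : forall n, 'I_(M n) -> set Z)
    (T : Z -> Y) (C : set Y) :
  (forall n z, exists i, A n i z) ->
  (forall n i z, A n i z -> closure (B n i) (T z)) -> closed C ->
  T @^-1` C = \bigcap_n \big[setU/set0]_(i in meets C n) A n i.
Proof.
move=> cA AT cC; apply/seteqP; split=> [z Cz n _|z Az].
  have [i Aiz] := cA n z; rewrite -bigcup_pred; exists i => //=.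
  by apply/asboolP; exists (T z); split => //; exact: AT.
apply: cC => V /nbhs_ballP[e /= e0 eV].
have e3 : 0 < e / 3 by exact: divr_gt0.
have [n Bn] := B_fine e3.
move: (Az n I); rewrite -bigcup_pred => -[i /= /asboolP[q [Bq Cq]] Aiz].
have [b [Bb zb]] := AT n i z Aiz _ (nbhsx_ballx (T z) _ e3).
have [b' [Bb' qb']] := Bq _ (nbhsx_ballx q _ e3).
exists q; split => //; apply: eV.
rewrite (_ : e = e / 3 + e / 3 + e / 3); last by field.
apply: ball_triangle (ball_sym qb').
exact: ball_triangle zb (Bn _ _ _ Bb Bb').
Qed.

(** The space [Z] is arbitrary so that this applies to [T] on [X] and to the identity on [Y];
    [meets C n] depends only on [B], so both sums run over the same indices. *)
Lemma vmeasure_preimage_closed {d} {Z : measurableType d} (mu : vmeasure Z S)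
    (A : forall n, 'I_(M n) -> set Z) (T : Z -> Y) (C : set Y) :
  (forall n, mpartition (A n)) ->
  (forall n i z, A n i z -> closure (B n i) (T z)) ->
  (forall n i j z, A n i z -> A n.+1 j z ->
     A n.+1 j `<=` A n i /\ B n.+1 j `<=` B n i) ->
  closed C ->
  measurable (T @^-1` C) /\
  \sum_(i in meets C n) mu (A n i) @[n --> \oo] --> mu (T @^-1` C).
Proof.
move=> pA AT nAB cC.
have mA n i : measurable (A n i) by have [] := pA n.
have cA n z : exists i, A n i z.
  have [_ _ UA] := pA n; have : setT z by [].
  by rewrite -UA => -[i _ Aiz]; exists i.
have mU n : measurable (\big[setU/set0]_(i in meets C n) A n i).
  by apply: bigsetU_measurable.
rewrite (preimage_closed_bigcap cA AT cC); split; first exact: bigcapT_measurable.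
have -> : (fun n => \sum_(i in meets C n) mu (A n i)) =
    (fun n => mu (\big[setU/set0]_(i in meets C n) A n i)).
  apply/funext => n; rewrite vmeasure_bigsetU ?index_enum_uniq//.
  by have [] := pA n.
(* A part whose counterpart has a closure meeting [C] lies in a coarser such part, so the unions
   decrease. *)
apply: vmeasure_cvg_bigcap => //; apply/nonincreasing_seqP => n.
apply/subsetPset => z; rewrite -!bigcup_pred => -[j /= /asboolP[q [Bq Cq]] Ajz].
have [i Aiz] := cA n z; exists i => //=; apply/asboolP; exists q; split => //.
exact: closure_subset (nAB _ _ _ _ Aiz Ajz).2 _ Bq.
Qed.

End partition_limit.
Arguments meets {R Y M} B C n.

(** * Successive refinements coded by mixed-radix numerals *)

Section mixed_radix.
Variables (Y : Type) (K : nat -> nat) (c : nat -> Y -> nat).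
Hypotheses (K_gt1 : forall n, (1 < K n)%N) (c_lt : forall n y, (c n y < K n)%N).

Fixpoint radix_size n : nat :=
  if n is n'.+1 then (radix_size n' * K n)%N else K 0%N.

(** All digits up to level [n] are packed into one number, the newest last: division by the last
    base recovers the coarser level, and parts stay indexed by an initial segment. *)
Fixpoint radix_code n (y : Y) : nat :=
  if n is n'.+1 then (radix_code n' y * K n + c n y)%N else c 0%N y.

Lemma radix_size_gt1 n : (1 < radix_size n)%N.
Proof.
elim: n => [|n ih]; first exact: K_gt1.
by rewrite [radix_size _]/= (leq_trans ih)// leq_pmulr// ltnW.
Qed.

Lemma radix_code_lt n y : (radix_code n y < radix_size n)%N.
Proof.
elim: n => [|n ih]; first exact: c_lt.
apply: (@leq_trans ((radix_code n y).+1 * K n.+1)).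
  by rewrite [radix_code _ _]/= mulSn addnC ltn_add2r.
by rewrite [radix_size _]/= leq_mul2r ih orbT.
Qed.

Lemma radix_code_div n y : (radix_code n.+1 y %/ K n.+1)%N = radix_code n y.
Proof.
have K0 : (0 < K n.+1)%N by rewrite ltnW.
by rewrite [radix_code n.+1 y]/= divnMDl// divn_small ?addn0.
Qed.

Lemma radix_code_mod n y : (radix_code n.+1 y %% K n.+1)%N = c n.+1 y.
Proof. by rewrite [radix_code n.+1 y]/= modnMDl modn_small. Qed.

Lemma radix_code_digit n y z : radix_code n y = radix_code n z -> c n y = c n z.
Proof. by case: n => [//|n] yz; rewrite -!radix_code_mod yz. Qed.

Lemma radix_code_preimage n k : radix_code n.+1 @^-1` [set k] =
  radix_code n @^-1` [set (k %/ K n.+1)%N] `&` c n.+1 @^-1` [set (k %% K n.+1)%N].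
Proof.
apply/seteqP; split=> y.
  by move=> <-; split; rewrite /preimage/= -/(radix_code n.+1 y)
    ?radix_code_div ?radix_code_mod.
move=> [/= yk ck]; rewrite -/(radix_code n.+1 y) (divn_eq k (K n.+1)).
by rewrite -yk -ck.
Qed.

End mixed_radix.

(** * Fine measurable partitions of a compact space *)

Section fine_codes.
Context {R : realType} {Y : pmetricType R}.

(** Recording the first set of the list that contains [x] turns a cover into a partition. *)
Lemma find_measurable {d} {T : measurableType d} {I : Type} (U : I -> set T)
    (r : seq I) (k : nat) : (forall i, measurable (U i)) ->
  measurable ((fun x => find (fun i => x \in U i) r) @^-1` [set k]).
Proof.
move=> mU; elim: r k => [|i r ih] k /=.
  by rewrite preimage_cst; case: ifP.
case: k => [|k].
  rewrite (_ : _ @^-1` _ = U i)//; apply/seteqP; split => x /=.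
    by case: ifPn => // /set_mem.
  by move=> /mem_set ->.
rewrite (_ : _ @^-1` _ =
    ~` U i `&` (fun x => find (fun i => x \in U i) r) @^-1` [set k]).
  by apply: measurableI => //; exact: measurableC.
apply/seteqP; split => x /=.
  by case: ifPn => // /negP xU [xk]; split => // /mem_set.
by move=> [xU <-]; rewrite memNset.
Qed.

Lemma compact_code (e : R) : compact [set: Y] -> 0 < e ->
  exists K (c : Y -> nat), [/\ (1 < K)%N, forall y, (c y < K)%N,
    forall k, measurable (c @^-1` [set k] : set (borel Y)) &
    forall y z, c y = c z -> ball y e z].
Proof.
move=> cY e0; pose e2 := PosNum (divr_gt0 e0 (ltr0Sn R 1)).
pose U (p : Y) : set Y := (ball p e2%:num)°.
have [D _ YD] : finite_subset_cover [set: Y] U [set: Y].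
  move: cY; rewrite compact_cover; apply.
    by move=> p _; exact: open_interior.
  by move=> y _; exists y => //; have [_] := open_nbhs_ball y e2.
pose r : seq Y := finmap.enum_fset D.
have hasU y : has (fun p => y \in U p) r.
  have [p /= pD Uy] := YD y I.
  by apply/hasP; exists p => //; exact: mem_set.
(* The codes are at most [size r]; the second successor ensures [1 < K]. *)
exists (size r).+2, (fun y => find (fun p => y \in U p) r); split => //.
- by move=> y; rewrite ltnS (leq_trans (find_size _ _)).
- move=> k; apply: (@find_measurable _ (borel Y)) => p.
  by apply: open_measurable_borel; exact: open_interior.
- move=> y z yz; have /set_mem/interior_subset := nth_find y (hasU y).
  have /set_mem/interior_subset := nth_find y (hasU z).
  by rewrite -yz => /[swap] /ball_sym; exact: ball_split.
Qed.

(* The sequence of partitions is given by the maps [C n] sending a point to the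
   index of its part; the part of level [n.+1] of [y] determines the one of
   level [n]. *)
Lemma compact_refining_codes : compact [set: Y] ->
  exists (M : nat -> nat) (C : nat -> Y -> nat),
  [/\ forall n, (1 < M n)%N, forall n y, (C n y < M n)%N,
      forall n k, measurable (C n @^-1` [set k] : set (borel Y)),
      forall n y z, C n.+1 y = C n.+1 z -> C n y = C n z &
      forall e : R, 0 < e -> exists n, forall y z, C n y = C n z -> ball y e z].
Proof.
move=> cY.
(* Unrelated codes are chosen for the radii [n.+1%:R^-1]; the numerals then make them refine one
   another. *)
have /choice[Kc KcP] n : exists Kc : nat * (Y -> nat), [/\ (1 < Kc.1)%N,
    forall y, (Kc.2 y < Kc.1)%N,
    forall k, measurable (Kc.2 @^-1` [set k] : set (borel Y)) &
    forall y z, Kc.2 y = Kc.2 z -> ball y (n.+1%:R^-1 : R) z].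
  have [|K [c Kc]] := @compact_code (n.+1%:R^-1) cY; first by rewrite invr_gt0.
  by exists (K, c).
pose K n := (Kc n).1; pose c n := (Kc n).2.
have K1 n : (1 < K n)%N by have [] := KcP n.
have cK n y : (c n y < K n)%N by have [_ + _ _] := KcP n; exact.
exists (radix_size K), (radix_code K c); split.
- exact: radix_size_gt1.
- exact: radix_code_lt.
- elim=> [|n ih] k; have [_ _ mc _] := KcP 0%N; first exact: mc.
  have {}mc : measurable (c n.+1 @^-1` [set (k %% K n.+1)%N] : set (borel Y)).
    by have [_ _ + _] := KcP n.+1; exact.
  by rewrite radix_code_preimage//; exact: measurableI.
- by move=> n y z yz;
    rewrite -(radix_code_div K1 cK n y) -(radix_code_div K1 cK n z) yz.
- move=> e e0; have [n en] := ltr_add_invr e0; exists n => y z yz.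
  have {}yz := radix_code_digit cK yz.
  have [_ _ _ /(_ _ _ yz)] := KcP n; apply: le_ball.
  by rewrite add0r in en; exact: ltW.
Qed.

End fine_codes.

(** * Domination and transport maps *)

Section domination_to_transport.
Context {R : realType} {S : completeNormedModType R}.
Context {d : measure_display} {X : measurableType d} {Y : pmetricType R}.

Lemma mpartition_part {d'} {Z : measurableType d'} n (A : 'I_n -> set Z) z :
  mpartition A -> exists i, A i z.
Proof.
by move=> [_ _ UA]; have : setT z by []; rewrite -UA => -[i _ Aiz]; exists i.
Qed.

Lemma mpartition_uniq {d'} {Z : measurableType d'} n (A : 'I_n -> set Z) z i j :
  mpartition A -> A i z -> A j z -> i = j.
Proof. by move=> [_ tA _] Ai Aj; apply: tA => //; exists z. Qed.

Lemma refinement_part {d'} {Z : measurableType d'} m n (A : 'I_m -> set Z)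
    (B : 'I_n -> set Z) z i j :
  mpartition B -> refinement A B -> A i z -> B j z -> A i `<=` B j.
Proof.
move=> pB AB Aiz Bjz; have [k ABk] := AB i.
by rewrite (mpartition_uniq pB Bjz (ABk _ Aiz)).
Qed.

(* When every level has at least two parts, an empty part of [B] forces the
   corresponding part of [A] to be empty, so nonempty nested parts of [A] select
   nonempty nested parts of [B], whose closures meet by compactness. *)
Lemma nested_partition_limit (M : nat -> nat) (A : forall n, 'I_(M n) -> set X)
    (B : forall n, 'I_(M n) -> set Y) :
  compact [set: Y] -> (forall n, (1 < M n)%N) -> (forall n, mpartition (A n)) ->
  (forall n, refinement (A n.+1) (A n)) ->
  (forall n (j : 'I_(M n)) (i : 'I_(M n.+1)),
     B n.+1 i `<=` B n j <-> A n.+1 i `<=` A n j) ->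
  forall x, exists y, forall n i, A n i x -> closure (B n i) y.
Proof.
move=> cY M1 pA rA BA x.
have nested n i j : A n i x -> A n.+1 j x -> B n.+1 j `<=` B n i.
  by move=> Ai Aj; apply/BA; exact: refinement_part Aj Ai.
have nonempty n i : A n i x -> B n i !=set0.
  move=> Ai; have [j Aj] := mpartition_part x (pA n.+1).
  apply: contrapT => Bi0.
  have Bj0 y : ~ B n.+1 j y.
    by move=> Bj; apply: Bi0; exists y; exact: (nested _ _ _ Ai Aj).
  (* The empty [B n.+1 j] lies in every part of level [n], hence so does [A n.+1 j]; then [x] is in
     the distinct parts 0 and 1. *)
  have Ak k : A n k x by apply: ((BA n k j).1 _ x Aj) => y /Bj0.
  have := mpartition_uniq (pA n) (Ak (Ordinal (ltnW (M1 n)))) (Ak (Ordinal (M1 n))).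
  by move=> /(congr1 val).
have /choice[y yP] n : exists y, forall i, A n i x -> B n i y.
  have [i Ai] := mpartition_part x (pA n); have [y By] := nonempty n i Ai.
  by exists y => j Aj; rewrite (mpartition_uniq (pA n) Aj Ai).
have yn n k i : A n i x -> B n i (y (n + k)%N).
  elim: k n i => [|k ih] n i Ai; first by rewrite addn0; exact: yP.
  have [j Aj] := mpartition_part x (pA n.+1).
  by rewrite addnS -addSn; apply: (nested _ _ _ Ai Aj); exact: ih.
(* A cluster point of [y] works, since from index [n] on the sequence stays in [B n i]. *)
have [p [_ pcl]] := cY (y @ \oo) _ (filterT : (y @ \oo) setT).
exists p => n i Ai V pV; apply: pcl pV.
by exists n => // k /= /subnKC <-; exact: yn.
Qed.

Lemma seq_dominates_transport (mu : vmeasure X S) (nu : vmeasure (borel Y) S) :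
  compact [set: Y] -> seq_dominates mu nu -> transport_maps mu nu !=set0.
Proof.
move=> cY dom; have [M [C [M1 CM mC Cref Cfine]]] := compact_refining_codes cY.
pose B n (i : 'I_(M n)) : set (borel Y) := C n @^-1` [set val i].
have pB n : mpartition (B n).
  split; first by move=> i; exact: mC.
  - by move=> i j _ _ [y [/= yi yj]]; apply: val_inj; rewrite -yi -yj.
  - by apply/seteqP; split => // y _; exists (Ordinal (CM n y)).
have nB n i j y : B n i y -> B n.+1 j y -> B n.+1 j `<=` B n i.
  by rewrite /B/= => <- yj z /= zj; apply: Cref; rewrite zj.
have rB n : refinement (B n.+1) (B n).
  move=> j; have [[y By]|Bj0] := pselect (B n.+1 j !=set0).
    have [i Bi] := mpartition_part y (pB n); exists i; exact: nB Bi By.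
  (* An empty part lies in any part; index 0 is the default. *)
  exists (Ordinal (ltnW (M1 n))) => y By; exfalso; apply: Bj0; by exists y.
have [A [pA rA AB BA]] := dom M B pB rB.
have /choice[T TP] := nested_partition_limit cY M1 pA rA BA.
exists T; apply: transport_maps_closed => D cD.
have fineB (e : R) : 0 < e ->
    exists n, forall i y z, B n i y -> B n i z -> ball (y : Y) e z.
  move=> e0; have [n nP] := Cfine e e0; exists n => i y z yi zi.
  by apply: nP; rewrite yi zi.
have [mTD muD] : measurable (T @^-1` D) /\
    \sum_(i in meets B D n) mu (A n i) @[n --> \oo] --> mu (T @^-1` D).
  apply: (vmeasure_preimage_closed fineB) => // [n i x|n i j x Ai Aj].
    exact: TP.
  have AA := refinement_part (pA n) (rA n) Aj Ai.
  by split => //; exact/BA.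
have [_ nuD] : measurable (id @^-1` D : set (borel Y)) /\
    \sum_(i in meets B D n) nu (B n i) @[n --> \oo] --> nu (id @^-1` D).
  apply: (vmeasure_preimage_closed fineB) => // [n i y|n i j y Bi Bj].
    exact: subset_closure.
  have BB := nB _ _ _ _ Bi Bj; by split.
split => //; apply: (cvg_unique _ muD) => //=.
rewrite (_ : (fun n => _) = (fun n => \sum_(i in meets B D n) nu (B n i)))//.
by apply/funext => n; apply: eq_bigr => i _; exact: AB.
Qed.

End domination_to_transport.

(** * From a transport map to domination *)

Section transport_to_domination.
Context {R : realType} {S : completeNormedModType R} {X Y : pmetricType R}.

Lemma set1_measurable_borel (x : X) : measurable ([set x] : set (borel X)).
Proof.
apply: closed_measurable_borel; apply: accessible_closed_set1.
by apply: hausdorff_accessible; exact: metric_hausdorff.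
Qed.

Lemma countable_measurable_borel (D : set X) :
  countable D -> measurable (D : set (borel X)).
Proof.
by apply: (@countable_measurable _ (borel X)); exact: set1_measurable_borel.
Qed.

Lemma measure_countable0 (m : {measure set (borel X) -> \bar R}) (D : set X) :
  (forall x : X, m [set x] = 0%E) -> countable D -> m D = 0%E.
Proof.
move=> m0 cD; apply/negligibleP; first exact: countable_measurable_borel.
have /pcard_surjP[g gD] := cD.
have DU : (D : set (borel X)) `<=` \bigcup_n [set g n].
  by move=> x /gD[n _ <-]; exists n.
apply: (negligibleS DU); apply: negligible_bigcup => n.
by apply/negligibleP; [exact: set1_measurable_borel|exact: m0].
Qed.

(* No point carries mass: [B `<=` [set x]] is empty or [[set x]], so the
   fractions property gives [mu [set x] = 0], while the density does not vanish. *)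
Lemma fractions_set1_null (mu : vmeasure (borel X) S) (x : X)
    (phi : S -> R^o) :
  has_fractions mu -> linear phi -> phi (vdensity mu x) = 1 ->
  vbase mu [set x] = 0%E.
Proof.
move=> frac lphi phi1; have mx := set1_measurable_borel x.
have [B [a [mB Bx /andP[a0 a1] muB]]] := frac _ mx.
have mux0 : mu [set x] = 0.
  have [Bx'|Bx'] := pselect (B x).
    have BE : B = [set x] by apply/seteqP; split => // _ ->.
    have /eqP : (1 - a) *: mu [set x] = 0 by rewrite scalerBl scale1r -muB BE subrr.
    by rewrite scaler_eq0 subr_eq0 gt_eqF//= => /eqP.
  have BE : B = set0 by rewrite -subset0 => y By; apply: Bx'; rewrite -(Bx _ By).
  move/eqP: muB; rewrite BE vmeasure0 eq_sym scaler_eq0 gt_eqF//=.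
  by move=> /eqP.
have phi0 : phi 0 = 0.
  by have := lphi (-1) 0 0; rewrite scaler0 addr0 scaleN1r addNr.
move/eqP: (vmeasure_set1 mu mx); rewrite mux0 eq_sym scaler_eq0 => /orP[/eqP m0|].
  by rewrite -[LHS]fineK ?m0// fin_num_measure.
by move=> /eqP eta0; move: phi1; rewrite eta0 phi0 => /esym/eqP; rewrite oner_eq0.
Qed.

(** On an infinite [X], distinct points [u (pickle i)] are reserved for the indices. A finite [X]
    may have too few points for that, so [g] is then a surjection onto [Y]. *)
Lemma countable_hitting_map (J : countType) (B : J -> set Y) :
  (finite_set [set: X] -> ([set: Y] #<= [set: X])%card) ->
  exists (D : set X) (g : X -> Y), countable D /\
    forall i, B i !=set0 -> exists2 x, D x & B i (g x).
Proof.
move=> cardYX.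
have [finX|/infiniteP/pcard_injP[u uinj]] :=
  pselect (finite_set [set: X]).
  have /pcard_surjP[g gs] := cardYX finX.
  exists setT, g; split; first exact: finite_set_countable.
  by move=> i [y By]; have [x _ xy] := gs y I; exists x; rewrite ?xy.
have /choice[g gP] x : exists y, forall i, x = u (pickle i) -> B i !=set0 -> B i y.
  have [[i [-> [y By]]]|Bx] := pselect (exists i, x = u (pickle i) /\ B i !=set0).
    exists y => j /uinj; rewrite !inE => /(_ I I)/(pcan_inj pickleK) <- //.
  by exists point => i xi Bi; exfalso; apply: Bx; exists i.
exists (range u), g; split.
  by apply: card_le_trans (card_image_le _ _) _; exact: countableP.
by move=> i Bi; exists (u (pickle i)); [exists (pickle i)|exact: gP].
Qed.

Lemma transport_seq_dominates (mu : vmeasure (borel X) S)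
    (nu : vmeasure (borel Y) S) :
  (forall x : X, vbase mu [set x] = 0%E) ->
  (finite_set [set: X] -> ([set: Y] #<= [set: X])%card) ->
  transport_maps mu nu !=set0 -> seq_dominates mu nu.
Proof.
move=> mu0 cardYX [T [mT TB]] M B pB rB.
(* Indexing by pairs of a level and a part treats all levels at once, so a single modification of
   [T] serves the whole sequence. *)
have [D [g [cD gD]]] := countable_hitting_map
  (fun p : {n & 'I_(M n)} => B (tag p) (tagged p)) cardYX.
have mD (E : set X) : E `<=` D -> measurable (E : set (borel X)).
  move=> ED; apply: countable_measurable_borel.
  exact: sub_countable (subset_card_le ED) cD.
pose T' x := if x \in D then g x else T x.
have T'D E : T' @^-1` E `\` D = T @^-1` E `\` D.
  by apply/seteqP; split=> x [+ Dx]; rewrite /T' /= memNset.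
have mT'E (E : set (borel Y)) :
    measurable E -> measurable (T' @^-1` E : set (borel X)).
  move=> mE; rewrite -(setUIDK (T' @^-1` E) D) T'D; apply: measurableU.
    by apply: mD; exact: subIsetr.
  by apply: measurableD; [rewrite -[_ @^-1` _]setTI; exact: mT|exact: mD].
exists (fun n i => T' @^-1` B n i); split.
- move=> n; have [mB tB UB] := pB n; split; first by move=> i; exact: mT'E.
    by move=> i j _ _ [x [Bi Bj]]; apply: tB => //; exists (T' x).
  by rewrite -preimage_bigcup UB preimage_setT.
- by move=> n i; have [j Bij] := rB n i; exists j; exact: preimage_subset.
- move=> n i; have [mB _ _] := pB n; rewrite -(TB _ (mB i)).
  apply: (@vmeasure_eq_off_null _ _ (borel X) _ mu _ _ D) => //.
  + exact: mT'E.
  + by rewrite -[_ @^-1` _]setTI; exact: mT.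
  + exact: mD.
  + exact: measure_countable0.
- move=> n j i; split=> [|AA y By]; first exact: preimage_subset.
  (* A nonempty [B n.+1 i] is hit at some [x] in [D]; [g x] lies in [B n j] and in the part [B n k]
     containing [B n.+1 i], so [j = k]. *)
  have [k Bk] := rB n i.
  have [x Dx Bx] : exists2 x, D x & B n.+1 i (g x).
    by apply: (gD (Tagged (fun n => 'I_(M n)) i)); exists y.
  have T'x : T' x = g x by rewrite /T' mem_set.
  have Bjx : B n j (g x) by rewrite -T'x; apply: AA; rewrite /= T'x.
  by rewrite (mpartition_uniq (pB n) Bjx (Bk _ Bx)); exact: Bk.
Qed.

End transport_to_domination.

(* The hypothesis mu0_card concerns only the zero measure mu = 0 on a finite X.
   There a transport map to nu = 0 always exists, whereas sequential domination
   forces Y to have at most as many points as X (a null part of a partition of Y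
   can be nonempty while all parts available in X are empty), so without this
   hypothesis the equivalence is false: take X a point, Y two points, S = R,
   densities 1 and both base measures zero. For mu <> 0 it holds vacuously. *)
Theorem theorem3p81 (R : realType) (X Y : pmetricType R)
    (S : completeNormedModType R) (F : set (S -> R^o))
    (mu : vmeasure (borel X) S) (nu : vmeasure (borel Y) S)
    (X_compact : compact [set: X]) (Y_compact : compact [set: Y])
    (F_subspace : dual_subspace F) (F_separates : separates_points F)
    (mu_fractions : has_fractions mu) (nu_fractions : has_fractions nu)
    (f_ex : exists2 f : X -> S -> R^o,
       dual_continuous F f & forall x : X, f x (vdensity mu x) = 1)
    (Y_complete : complete_space Y)
    (mu0_card : (forall A : set (borel X), measurable A -> mu A = 0) ->
       finite_set [set: X] -> ([set: Y] #<= [set: X])%card) :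
  seq_dominates mu nu <-> transport_maps mu nu !=set0.
Proof.
have [f [Ff _] f1] := f_ex; have [F_dual _ _] := F_subspace.
have mu0 (x : X) : vbase mu [set x] = 0%E.
  have [fx_linear _] := F_dual _ (Ff x).
  exact: fractions_set1_null mu_fractions fx_linear (f1 x).
split; first exact: seq_dominates_transport.
(* Every subset of a finite [X] is countable, hence null, so [mu] vanishes and [mu0_card]
   applies. *)
apply: transport_seq_dominates => // X_finite; apply: mu0_card => // A mA.
rewrite -(vmeasure0 mu); apply: (@vmeasure_eq_off_null _ _ (borel X) _ mu _ _ A) => //.
  apply: measure_countable0 => //; apply: finite_set_countable.
  exact: sub_finite_set X_finite.
by rewrite setDv set0D.
Qed.
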